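(* Let $n,q\in\{1,2,\ldots\}$, let $\|\cdot\|$ be a norm on $\mathbb{R}^q$, let $C\subseteq\mathbb{R}^q$ be a closed convex cone that is solid, pointed and nontrivial, let $X\subseteq\mathbb{R}^n$ be convex, let $\Gamma\colon X\to\mathbb{R}^q$ be $C$-convex and continuous, and let $\mathcal{X}\subseteq X$ be a compact convex set with nonempty interior. Then, for every $v\in\mathbb{R}^q$, the problem $$(\mathrm{P}(v))\qquad \text{minimize } \|z\| \ \text{ subject to } \ \Gamma(x)-z-v\leq_C 0,\ x\in\mathcal{X},\ z\in\mathbb{R}^q$$ has an optimal solution $(x^v,z^v)$, its Lagrangian dual problem $$(\mathrm{D}(v))\qquad \text{maximize } \phi(w)\ \text{ subject to } w\in\mathbb{R}^q$$ has an optimal solution $w^v$, and the optimal values of $(\mathrm{P}(v))$ and $(\mathrm{D}(v))$ coincide.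
   Context: A cone $C$ is solid if its interior is nonempty, pointed if it contains no line, nontrivial if $\{0\}\subsetneq C\subsetneq\mathbb{R}^q$. For $y_1,y_2\in\mathbb{R}^q$, $y_1\leq_C y_2$ means $y_2-y_1\in C$. $\Gamma$ is $C$-convex if $\Gamma(\lambda x_1+(1-\lambda)x_2)\leq_C\lambda\Gamma(x_1)+(1-\lambda)\Gamma(x_2)$ for all $x_1,x_2\in X$, $\lambda\in[0,1]$. The dual cone is $C^+=\{w\in\mathbb{R}^q\mid w^{\mathsf T}y\ge 0\ \forall y\in C\}$. The dual objective function $\phi\colon\mathbb{R}^q\to[-\infty,+\infty]$ is $$\phi(w)=\begin{cases}\inf_{x\in\mathcal{X},\,z\in\mathbb{R}^q}\big(\|z\|+w^{\mathsf T}(\Gamma(x)-z-v)\big) & \text{if } w\in C^+,\\ -\infty & \text{otherwise.}\end{cases}$$ Equivalently, with $\|\cdot\|_*$ the dual norm, $(\mathrm{D}(v))$ is to maximize $\inf_{x\in\mathcal{X}}w^{\mathsf T}\Gamma(x)-w^{\mathsf T}v$ over $w\in C^+$ with $\|w\|_*\le 1$. *)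

(* Defs.v *)
From mathcomp Require Import all_boot all_order all_algebra.
From mathcomp Require Import all_classical all_reals all_analysis.

Set Implicit Arguments.
Unset Strict Implicit.
Unset Printing Implicit Defensive.

Import Order.TTheory GRing.Theory Num.Theory.
Import numFieldNormedType.Exports.

Local Open Scope classical_set_scope.
Local Open Scope ring_scope.

(* R^q is 'cV[R]_q with the library's topology of entrywise convergence, which
   is the one induced by any norm on R^q. An arbitrary norm is thus a function
   satisfying is_norm, independent of the canonical (sup) norm `|_| on 'cV. *)
Record is_norm (R : realType) (q : nat) (N : 'cV[R]_q -> R) : Prop := IsNorm {
  norm_triangle : forall y z, N (y + z) <= N y + N z ;
  norm_homog : forall (t : R) y, N (t *: y) = `|t| * N y ;
  norm_eq0 : forall y, N y = 0 -> y = 0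
}.

Definition dotp (R : realType) (q : nat) (w y : 'cV[R]_q) : R :=
  (w^T *m y) 0 0.

Definition is_cone (R : realType) (q : nat) (C : set 'cV[R]_q) : Prop :=
  forall (t : R) y, 0 <= t -> C y -> C (t *: y).

Definition solid (R : realType) (q : nat) (C : set 'cV[R]_q) : Prop :=
  C° !=set0.

Definition pointed_cone (R : realType) (q : nat) (C : set 'cV[R]_q) : Prop :=
  ~ exists y d : 'cV[R]_q, d != 0 /\ forall t : R, C (y + t *: d).

Definition nontrivial_cone (R : realType) (q : nat) (C : set 'cV[R]_q) : Prop :=
  [set 0] `<` C /\ C `<` setT.

Definition cone_le (R : realType) (q : nat) (C : set 'cV[R]_q)
    (y1 y2 : 'cV[R]_q) : Prop := C (y2 - y1).

(* A map X -> R^q is a total function on R^n whose values outside X are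
   irrelevant: they are never constrained nor used. *)
Definition cone_convex (R : realType) (n q : nat) (C : set 'cV[R]_q)
    (X : set 'cV[R]_n) (Gamma : 'cV[R]_n -> 'cV[R]_q) : Prop :=
  forall (x1 x2 : 'cV[R]_n) (t : R), X x1 -> X x2 -> 0 <= t <= 1 ->
    cone_le C (Gamma (t *: x1 + (1 - t) *: x2))
              (t *: Gamma x1 + (1 - t) *: Gamma x2).

Definition dual_cone (R : realType) (q : nat) (C : set 'cV[R]_q) :
    set 'cV[R]_q :=
  [set w | forall y, C y -> 0 <= dotp w y].

(* XX is the feasible region written as a calligraphic X in the mathematics. *)
Definition primal_feasible (R : realType) (n q : nat) (C : set 'cV[R]_q)
    (XX : set 'cV[R]_n) (Gamma : 'cV[R]_n -> 'cV[R]_q) (v : 'cV[R]_q) :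
    set ('cV[R]_n * 'cV[R]_q) :=
  [set p | XX p.1 /\ cone_le C (Gamma p.1 - p.2 - v) 0].

Definition primal_optimal (R : realType) (n q : nat) (N : 'cV[R]_q -> R)
    (C : set 'cV[R]_q) (XX : set 'cV[R]_n) (Gamma : 'cV[R]_n -> 'cV[R]_q)
    (v : 'cV[R]_q) (x : 'cV[R]_n) (z : 'cV[R]_q) : Prop :=
  primal_feasible C XX Gamma v (x, z) /\
  forall x' z', primal_feasible C XX Gamma v (x', z') -> N z <= N z'.

Definition primal_value (R : realType) (n q : nat) (N : 'cV[R]_q -> R)
    (C : set 'cV[R]_q) (XX : set 'cV[R]_n) (Gamma : 'cV[R]_n -> 'cV[R]_q)
    (v : 'cV[R]_q) : \bar R :=
  ereal_inf [set (N p.2)%:E | p in primal_feasible C XX Gamma v].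

Definition dual_objective (R : realType) (n q : nat) (N : 'cV[R]_q -> R)
    (C : set 'cV[R]_q) (XX : set 'cV[R]_n) (Gamma : 'cV[R]_n -> 'cV[R]_q)
    (v w : 'cV[R]_q) : \bar R :=
  if `[< dual_cone C w >] then
    ereal_inf [set (N p.2 + dotp w (Gamma p.1 - p.2 - v))%:E
              | p in XX `*` [set: 'cV[R]_q]]
  else -oo%E.

Definition dual_optimal (R : realType) (n q : nat) (N : 'cV[R]_q -> R)
    (C : set 'cV[R]_q) (XX : set 'cV[R]_n) (Gamma : 'cV[R]_n -> 'cV[R]_q)
    (v w : 'cV[R]_q) : Prop :=
  forall w', (dual_objective N C XX Gamma v w' <=
              dual_objective N C XX Gamma v w)%E.

Definition dual_value (R : realType) (n q : nat) (N : 'cV[R]_q -> R)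
    (C : set 'cV[R]_q) (XX : set 'cV[R]_n) (Gamma : 'cV[R]_n -> 'cV[R]_q)
    (v : 'cV[R]_q) : \bar R :=
  ereal_sup (range (dual_objective N C XX Gamma v)).

(* Main.v *)
Require Import Defs.
From mathcomp Require Import all_boot all_order all_algebra.
From mathcomp Require Import all_classical all_reals all_analysis.
From mathcomp Require Import ring lra.

Import Order.TTheory GRing.Theory Num.Theory.
Import numFieldNormedType.Exports.

Local Open Scope classical_set_scope.
Local Open Scope ring_scope.

(** Write S for the upper image of the problem: the set of all z such that
    (x, z) is feasible for some x.  Since Gamma is C-convex, S is convex, and
    S + C is contained in S.

    The primal problem minimizes N over S.  The image of the compact feasible
    region is compact and the sublevel sets of N are compact (all norms on R^q
    are equivalent), so the minimum c is attained.

    For the dual, weak duality bounds every dual value by c, so it suffices to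
    produce w in the dual cone whose dual value is at least c.  Geometrically w
    separates S from the open ball of radius c, scaled to dual norm 1.  The
    Mazur-Orlicz theorem ([mazur_orlicz]) gives it already scaled, and without
    treating c = 0 separately: N is sublinear and N >= c on the convex set S,
    so there is a linear functional w with w <= N everywhere and w >= c on S.
    The first inequality cancels z from the Lagrangian, the second bounds what
    is left, and since w is bounded below on S, which absorbs C, it is
    nonnegative on C.

    Mazur-Orlicz rests on one construction, [tilt]: from a sublinear p with
    p >= c on S it makes a smaller sublinear functional whose value at -s is at
    most -c for every s in S.  Tilting along the singletons {e_i} with
    c = p e_i makes p odd on each basis vector in turn, and a sublinear
    functional that is odd on a basis is linear; this is the finite-dimensional
    Hahn-Banach theorem.  Tilting N along S itself before applying it yields
    the bound on S. *)

Set Implicit Arguments.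
Unset Strict Implicit.
Unset Printing Implicit Defensive.

(** * Convex sets and convex cones *)

Lemma convex_setP (R : realType) (V : lmodType R) (A : set V) :
  convex_set A <->
  forall x y (t : R), A x -> A y -> 0 <= t <= 1 -> A (t *: x + (1 - t) *: y).
Proof.
split=> [cA x y t Ax Ay /andP[t0 t1]|cA x y t].
  have := cA x y (Itv01 t0 t1) (mem_set Ax) (mem_set Ay).
  by rewrite inE.
rewrite !inE => Ax Ay; apply: cA => //.
by rewrite ge0 le1.
Qed.

(** The form of convexity needed to add two rays: unnormalized weights, which
    may both vanish. *)
Lemma convex_set_sum (R : realType) (V : lmodType R) (S : set V) x y (a b : R) :
  convex_set S -> S x -> S y -> 0 <= a -> 0 <= b ->
  exists2 s, S s & a *: x + b *: y = (a + b) *: s.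
Proof.
move=> /convex_setP cS Sx Sy a0 b0.
have [ab0|ab0] := eqVneq (a + b) 0.
  have a00 : a = 0 by lra.
  have b00 : b = 0 by lra.
  by exists x => //; rewrite a00 b00 addr0 !scale0r addr0.
exists ((a / (a + b)) *: x + (1 - a / (a + b)) *: y).
  apply: cS => //; rewrite divr_ge0 ?addr_ge0//=.
  by rewrite ler_pdivrMr ?mul1r ?lerDl// lt_neqAle eq_sym ab0 addr_ge0.
rewrite scalerDr !scalerA; congr (_ *: _ + _ *: _); field => //.
Qed.

Lemma convex_coneD (R : realType) (q : nat) (C : set 'cV[R]_q) y z :
  convex_set C -> is_cone C -> C y -> C z -> C (y + z).
Proof.
move=> cC kC Cy Cz.
have [s Cs] := convex_set_sum cC Cy Cz ler01 ler01.
by rewrite !scale1r => ->; apply: kC => //; rewrite addr_ge0.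
Qed.

(** * Sublinear functionals and their tilts *)

Section Sublinear.
Context (R : realType) (V : lmodType R).

(** Homogeneity is asked only as an inequality, which is the part that has to
    be checked; equality follows by rescaling back ([sublinearZ]). *)
Record sublinear (p : V -> R) : Prop := Sublinear {
  sublinearD : forall x y, p (x + y) <= p x + p y ;
  sublinearZ_le : forall t x, 0 <= t -> p (t *: x) <= t * p x }.

Section Properties.
Context (p : V -> R) (sp : sublinear p).

Lemma sublinear0 : p 0 = 0.
Proof.
have h1 := sublinearD sp 0 0.
have h2 := sublinearZ_le sp 0 (lexx (0 : R)).
rewrite addr0 in h1; rewrite scale0r mul0r in h2; lra.
Qed.

Lemma sublinearZ t x : 0 <= t -> p (t *: x) = t * p x.
Proof.
rewrite le_eqVlt => /predU1P[<-|t0]; first by rewrite scale0r mul0r sublinear0.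
apply/le_anti/andP; split; first exact/sublinearZ_le/ltW.
rewrite -ler_pdivlMl// -{1}(scale1r x) -(mulVf (lt0r_neq0 t0)) -scalerA.
by apply: sublinearZ_le; rewrite ?invr_ge0 ?ltW.
Qed.

Lemma sublinearN x : - p (- x) <= p x.
Proof. by have := sublinearD sp x (- x); rewrite subrr sublinear0; lra. Qed.

End Properties.

(** When p is sublinear and p >= c on a nonempty convex set S, this is the
    largest sublinear functional that is below p and at most -c on -S. *)
Definition tilt (p : V -> R) (S : set V) (c : R) (x : V) : R :=
  inf [set p (x + ts.1 *: ts.2) - ts.1 * c | ts in [set t | 0 <= t] `*` S].

Section Tilt.
Context (p : V -> R) (S : set V) (c : R).
Hypotheses (sp : sublinear p) (cS : convex_set S) (S0 : S !=set0).
Hypothesis (pS : forall s, S s -> c <= p s).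

Let le_tilt x a :
  (forall t s, 0 <= t -> S s -> a <= p (x + t *: s) - t * c) ->
  a <= tilt p S c x.
Proof.
move=> h; apply: lb_le_inf.
  by case: S0 => s Ss; apply: image_nonempty; exists (0, s); split => /=.
by move=> _ [[t s] [/= t0 Ss] <-]; exact: h.
Qed.

(** The infimum is finite because p (x + t s) >= t p s - p (- x), and
    t p s >= t c. *)
Lemma tilt_le_shift x t s :
  0 <= t -> S s -> tilt p S c x <= p (x + t *: s) - t * c.
Proof.
move=> t0 Ss; apply: ge_inf; last by exists (t, s).
exists (- p (- x)) => _ [[u r] [/= u0 Sr] <-].
have := sublinearD sp (x + u *: r) (- x).
rewrite addrC addrA addNr add0r sublinearZ//.
by have := ler_wpM2l u0 (pS Sr); lra.
Qed.

Lemma tilt_le x : tilt p S c x <= p x.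
Proof.
have [s Ss] := S0.
by have := tilt_le_shift x (lexx 0) Ss; rewrite scale0r mul0r addr0 subr0.
Qed.

Lemma tilt_opp s : S s -> tilt p S c (- s) <= - c.
Proof.
move=> Ss; have := tilt_le_shift (- s) ler01 Ss.
by rewrite scale1r addNr sublinear0// mul1r sub0r.
Qed.

Lemma tilt_sublinear : sublinear (tilt p S c).
Proof.
split=> [x y|t x].
  rewrite -lerBlDr; apply: le_tilt => t s t0 Ss.
  rewrite lerBlDl -lerBlDr; apply: le_tilt => u r u0 Sr.
  have [m Sm mE] := convex_set_sum cS Ss Sr t0 u0.
  have := tilt_le_shift (x + y) (addr_ge0 t0 u0) Sm.
  have := sublinearD sp (x + t *: s) (y + u *: r).
  by rewrite -mE addrACA; lra.
rewrite le_eqVlt => /predU1P[<-|t0].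
  by rewrite scale0r mul0r (le_trans (tilt_le _))// sublinear0.
rewrite mulrC -ler_pdivrMr//; apply: le_tilt => u r u0 Sr.
rewrite ler_pdivrMr// mulrBl mulrC -(sublinearZ sp _ (ltW t0)) scalerDr scalerA.
rewrite (_ : u * c * t = (t * u) * c); last by ring.
by apply: tilt_le_shift => //; rewrite mulr_ge0// ltW.
Qed.

End Tilt.
End Sublinear.

(** * Linear minorants: the theorems of Hahn-Banach and Mazur-Orlicz *)

Section Dotp.
Context (R : realType) (q : nat).
Implicit Types w y z : 'cV[R]_q.

Lemma dotpDr w y z : dotp w (y + z) = dotp w y + dotp w z.
Proof. by rewrite /dotp mulmxDr mxE. Qed.

Lemma dotpNr w y : dotp w (- y) = - dotp w y.
Proof. by rewrite /dotp mulmxN mxE. Qed.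

Lemma dotpZr w t y : dotp w (t *: y) = t * dotp w y.
Proof. by rewrite /dotp -scalemxAr mxE. Qed.

Lemma cV_sum_delta y : y = \sum_i y i 0 *: delta_mx i 0.
Proof.
rewrite {1}(matrix_sum_delta y); apply: eq_bigr => i _.
by rewrite big_ord1.
Qed.

End Dotp.

Section HahnBanach.
Context (R : realType) (q : nat).
Implicit Types p : 'cV[R]_q -> R.

(** Tilting p' along {e} with c = p' e brings the value at - e down to - p' e.
    The inequality p' (- e) <= - p' e, which for a sublinear p' means oddness
    at e, persists when p' decreases; so the vectors of l can be treated one
    after the other. *)
Lemma sublinear_minorant_odd p (l : seq 'cV[R]_q) : sublinear p ->
  exists p', [/\ sublinear p', forall x, p' x <= p x &
    forall e, e \in l -> p' (- e) <= - p' e].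
Proof.
move=> sp; elim: l => [|e l [p' [sp' p'p p'l]]]; first by exists p.
have cS : convex_set [set e].
  by apply/convex_setP => _ _ t -> -> _ /=; rewrite -scalerDl subrKC scale1r.
have S0 : [set e] !=set0 by exists e.
have pS s : [set e] s -> p' e <= p' s by move=> ->.
pose p2 := tilt p' [set e] (p' e).
have p2p' x : p2 x <= p' x by exact: tilt_le.
exists p2; split; first exact: tilt_sublinear.
  by move=> x; exact: le_trans (p2p' x) (p'p x).
move=> f; rewrite inE => /predU1P[->|fl].
  apply: le_trans (tilt_opp sp' pS (erefl e)) _.
  by rewrite lerN2.
by apply: le_trans (p2p' _) (le_trans (p'l f fl) _); rewrite lerN2.
Qed.

(** A sublinear p' that is odd on the basis is bounded above by the linear
    functional with the same values there; using this at - x as well, the two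
    coincide. *)
Lemma sublinear_minorant_linear p : sublinear p ->
  exists w, forall x, dotp w x <= p x.
Proof.
move=> sp.
have [p' [sp' p'p p'e]] :=
  sublinear_minorant_odd [seq delta_mx i 0 | i : 'I_q] sp.
pose w : 'cV[R]_q := \col_i p' (delta_mx i 0).
have p'Z (t : R) i : p' (t *: delta_mx i 0) <= t * w i 0.
  rewrite mxE; have [t0|t0] := leP 0 t; first exact: sublinearZ_le.
  have nt0 : 0 <= - t by rewrite oppr_ge0 ltW.
  have -> : t *: delta_mx i 0 = - t *: - delta_mx i 0 :> 'cV[R]_q.
    by rewrite scalerN scaleNr opprK.
  apply: le_trans (sublinearZ_le sp' _ nt0) _.
  by rewrite -[leRHS]mulrNN ler_wpM2l// p'e//; exact: codom_f.
have p'w x : p' x <= dotp w x.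
  rewrite {1}(cV_sum_delta x) /dotp mxE.
  elim/big_ind2 : _ => [|a b a' b' ha hb|i _].
  - by rewrite sublinear0.
  - exact: le_trans (sublinearD sp' _ _) (lerD ha hb).
  - by apply: le_trans (p'Z _ _) _; rewrite [w^T _ _]mxE mulrC.
exists w => x; apply: le_trans (p'p x).
apply: le_trans (sublinearN sp' x).
by rewrite lerNr -dotpNr.
Qed.

Lemma mazur_orlicz p (S : set 'cV[R]_q) (c : R) :
  sublinear p -> convex_set S -> S !=set0 -> (forall s, S s -> c <= p s) ->
  exists w, (forall x, dotp w x <= p x) /\ (forall s, S s -> c <= dotp w s).
Proof.
move=> sp cS S0 pS.
have [w wp] := sublinear_minorant_linear (tilt_sublinear sp cS S0 pS).
exists w; split=> [x|s Ss]; first exact: le_trans (wp x) (tilt_le sp S0 pS x).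
by have := le_trans (wp (- s)) (tilt_opp sp pS Ss); rewrite dotpNr lerN2.
Qed.

End HahnBanach.

(** * Topology of an arbitrary norm on R^q *)

Section Norm.
Context (R : realType) (q : nat) (N : 'cV[R]_q -> R) (N_norm : is_norm N).

Lemma is_norm_sublinear : sublinear N.
Proof.
by case: N_norm => ND NZ _; split=> // t x t0; rewrite NZ ger0_norm.
Qed.

Lemma is_normN y : N (- y) = N y.
Proof. by rewrite -scaleN1r (norm_homog N_norm) normrN1 mul1r. Qed.

Lemma is_norm_ge0 y : 0 <= N y.
Proof. by have := sublinearN is_norm_sublinear y; rewrite is_normN; lra. Qed.

Lemma norm_le_supnorm : exists2 K, 0 <= K & forall y, N y <= K * `|y|.
Proof.
exists (\sum_i N (delta_mx i 0)) => [|y].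
  by apply: sumr_ge0 => i _; exact: is_norm_ge0.
rewrite {1}(cV_sum_delta y) mulr_suml.
elim/big_ind2 : _ => [|a b a' b' ha hb|i _].
- by rewrite (sublinear0 is_norm_sublinear).
- exact: le_trans (norm_triangle N_norm _ _) (lerD ha hb).
- rewrite (norm_homog N_norm) mulrC ler_wpM2l ?is_norm_ge0//.
  rewrite [leRHS]/Num.norm/= mx_normrE.
  by apply/bigmax_geP; right; exists (i, 0).
Qed.

Lemma is_norm_continuous : continuous N.
Proof.
have [K K0 NK] := norm_le_supnorm.
move=> x; apply/(@cvgrPdist_le _ _ _ _ (nbhs_filter x)) => e e0.
have K1 : 0 < K + 1 by rewrite ltr_wpDl.
apply/nbhs_ballP; exists (e / (K + 1)) => /=; first by rewrite divr_gt0.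
move=> y; rewrite -ball_normE /= ltr_pdivlMr// => xy.
have h1 := norm_triangle N_norm (x - y) y.
have h2 := norm_triangle N_norm (y - x) x.
rewrite !subrK in h1 h2.
have h3 := NK (x - y).
rewrite -(opprB x y) is_normN in h2.
have := normr_ge0 (x - y).
by rewrite ler_norml; nra.
Qed.

(** Heine-Borel, carried over from row vectors by transposition. *)
Lemma cV_bounded_closed_compact (A : set 'cV[R]_q) :
  bounded_set A -> closed A -> compact A.
Proof.
move=> [M [Mreal AM]] cA.
have trc m l : continuous (@trmx R m l).
  move=> x s /= /nbhs_ballP [e e0 es].
  apply/nbhs_ballP; exists e => //= y [_ xy].
  by apply: es; split=> // i j; rewrite !mxE; exact: xy.
have tr_norm (x : 'rV[R]_q) : `|x| <= `|x^T|.
  rewrite [leLHS]/Num.norm [leRHS]/Num.norm/= !mx_normrE.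
  apply: bigmax_le => [|[i j] _ /=]; first exact: bigmax_ge_id.
  by apply/bigmax_geP; right; exists (j, i); rewrite //= mxE.
rewrite (_ : A = trmx @` (@trmx R 1 q @^-1` A)); last first.
  apply/seteqP; split=> [x Ax|_ [x Ax <-]//].
  by exists x^T; rewrite /= trmxK.
apply: continuous_compact; first by apply: continuous_subspaceT; exact: trc.
apply: bounded_closed_compact.
  exists M; split=> // L ML x /= Ax; exact: le_trans (tr_norm x) (AM _ ML _ Ax).
by apply: preimage_closed => // x _; exact: trc.
Qed.

(** The constant is the minimum of N on the unit sphere of the sup norm, which
    is attained at a nonzero vector.  In dimension 0 the sphere is empty. *)
Lemma supnorm_le_norm : exists2 k, 0 < k & forall y, k * `|y| <= N y.
Proof.
pose S : set 'cV[R]_q := [set y | `|y| = 1].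
have Sc : compact S.
  apply: cV_bounded_closed_compact.
    by exists 1; split=> // M M1 y /= ->; exact: ltW.
  rewrite (_ : S = (fun y : 'cV[R]_q => `|y|) @^-1` [set 1])//.
  apply: preimage_closed => [y _|]; first exact: norm_continuous.
  exact: closed_eq.
have Snormed y : y != 0 -> S (`|y|^-1 *: y).
  move=> y0; rewrite /S/= normrZ normfV normr_id mulVf// normr_eq0//.
have [S0|/set0P S0] := eqVneq S set0.
  exists 1 => // y; have [->|y0] := eqVneq y 0.
    by rewrite normr0 mulr0 is_norm_ge0.
  by have := Snormed y y0; rewrite S0.
have NS : {within S, continuous N}.
  by apply: continuous_subspaceT; exact: is_norm_continuous.
have [m] := compact_EVT_min S0 Sc NS.
rewrite inE => Sm Nm; exists (N m) => [|y].
  rewrite lt_neqAle is_norm_ge0 andbT eq_sym.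
  apply/eqP => /(norm_eq0 N_norm) m0.
  by move: Sm; rewrite /S/= m0 normr0 => /eqP; rewrite eq_sym oner_eq0.
have [->|y0] := eqVneq y 0; first by rewrite normr0 mulr0 is_norm_ge0.
have yp : 0 < `|y| by rewrite normr_gt0.
have := Nm _ (mem_set (Snormed _ y0)).
by rewrite (norm_homog N_norm) ger0_norm ?invr_ge0// mulrC ler_pdivlMr.
Qed.

Lemma norm_sublevel_compact r : compact [set y | N y <= r].
Proof.
have [k k0 kN] := supnorm_le_norm.
apply: cV_bounded_closed_compact.
  exists (r / k); split; first exact: num_real.
  move=> M rM y /= Nyr; apply: le_trans (ltW rM).
  by rewrite ler_pdivlMr// mulrC (le_trans (kN y)).
rewrite (_ : [set y | _] = N @^-1` [set t | t <= r])//.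
apply: preimage_closed => [y _|]; first exact: is_norm_continuous.
exact: closed_le.
Qed.

End Norm.

(** * Weak duality, upper image and dual cone *)

Section Duality.
Context (R : realType) (n q : nat) (N : 'cV[R]_q -> R).
Context (C : set 'cV[R]_q) (C_cone : is_cone C).
Context (XX : set 'cV[R]_n) (Gamma : 'cV[R]_n -> 'cV[R]_q).
Context (v : 'cV[R]_q).

Definition upper_image : set 'cV[R]_q :=
  [set z | exists x, primal_feasible C XX Gamma v (x, z)].

Lemma weak_duality w x z : primal_feasible C XX Gamma v (x, z) ->
  (dual_objective N C XX Gamma v w <= (N z)%:E)%E.
Proof.
move=> [/= XXx Cxz]; rewrite /dual_objective.
case: asboolP => [wC|_]; last exact: leNye.
apply: (@le_trans _ _ (N z + dotp w (Gamma x - z - v))%:E).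
  by apply: ereal_inf_lbound; exists (x, z).
have := wC _ Cxz; rewrite sub0r dotpNr lee_fin; lra.
Qed.

Lemma dual_objective_ge w c : dual_cone C w ->
  (forall x z, XX x -> c <= N z + dotp w (Gamma x - z - v)) ->
  (c%:E <= dual_objective N C XX Gamma v w)%E.
Proof.
move=> wC h; rewrite /dual_objective asboolT//.
by apply: le_ereal_inf_tmp => _ [[x z] [/= XXx _] <-]; rewrite lee_fin h.
Qed.

Lemma upper_image_convex (X : set 'cV[R]_n) : convex_set C ->
  cone_convex C X Gamma -> XX `<=` X -> convex_set XX ->
  convex_set upper_image.
Proof.
move=> cC gC XXX /convex_setP cX; apply/convex_setP => y z t.
move=> [x1 [/= X1 C1]] [x2 [/= X2 C2]] t01.
have /andP[t0 t1] := t01.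
exists (t *: x1 + (1 - t) *: x2); split; first exact: cX.
have := gC _ _ _ (XXX _ X1) (XXX _ X2) t01.
have s0 : 0 <= 1 - t by lra.
have := convex_coneD cC C_cone (C_cone t0 C1) (C_cone s0 C2).
move=> h1 h2; have := convex_coneD cC C_cone h1 h2; rewrite /cone_le.
congr (C _); apply/colP => i; rewrite !mxE /=; ring.
Qed.

(** If w were negative at some y of C, moving far enough from a point of S in
    the direction y would push w below its lower bound. *)
Lemma dual_cone_lbound S c w : S !=set0 ->
  (forall y s, C y -> S s -> S (s + y)) -> (forall s, S s -> c <= dotp w s) ->
  dual_cone C w.
Proof.
move=> [s Ss] SC cS y Cy; rewrite leNgt; apply/negP => wy.
(* t is chosen so that w (s + t y) = c - 1. *)
pose t := (dotp w s - c + 1) / - dotp w y.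
have t0 : 0 <= t.
  by rewrite divr_ge0// ?oppr_ge0 ?ltW// ltr_wpDl// subr_ge0 cS.
have := cS _ (SC _ _ (C_cone t0 Cy) Ss).
have -> : dotp w (s + t *: y) = c - 1.
  by rewrite dotpDr dotpZr /t; field; rewrite lt_eqF.
lra.
Qed.

End Duality.

(** * Attainment and strong duality *)

Section Attainment.
Context (R : realType) (n q : nat) (N : 'cV[R]_q -> R) (N_norm : is_norm N).

(** The compactness argument runs over pairs (k, z) with k in the image of XX
    under Gamma, since in (k, z) the cone constraint is the preimage of C under
    a globally continuous map, whereas Gamma is continuous only within XX. *)
Lemma primal_attained (C : set 'cV[R]_q) (XX : set 'cV[R]_n)
    (Gamma : 'cV[R]_n -> 'cV[R]_q) (v : 'cV[R]_q) :
  closed C -> C 0 -> compact XX -> XX !=set0 -> {within XX, continuous Gamma} ->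
  exists x z, primal_optimal N C XX Gamma v x z.
Proof.
move=> cC C0 cXX [x0 XXx0] cG.
(* z0 is feasible together with x0, so larger values of N are irrelevant. *)
pose z0 := Gamma x0 - v.
pose h (p : 'cV[R]_q * 'cV[R]_q) := 0 - (p.1 - p.2 - v).
pose F := (Gamma @` XX `*` [set z | N z <= N z0]) `&` (h @^-1` C).
have h_cont : continuous h.
  move=> p; apply: cvgB; first exact: cvg_cst.
  apply: cvgB; last exact: cvg_cst.
  by apply: cvgB; [exact: cvg_fst|exact: cvg_snd].
have cF : compact F.
  apply: compact_closedI.
    apply: compact_setX; first exact: continuous_compact.
    exact: norm_sublevel_compact.
  by apply: preimage_closed => // p _; exact: h_cont.
have F0 : F !=set0.
  exists (Gamma x0, z0); split=> /=; first by split; [exists x0|exact: lexx].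
  by rewrite /h /z0 /= subKr subrr subr0.
have NF : {within F, continuous (fun p => N p.2)}.
  apply: continuous_subspaceT => p.
  by apply: continuous_comp; [exact: cvg_snd|exact: is_norm_continuous].
have [[k z]] := compact_EVT_min F0 cF NF.
rewrite inE => -[[/= [x XXx <-] Nz] Cz] zmin.
exists x, z; split=> // x' z' [/= XXx' Cz'].
have [zz|/ltW zz] := leP (N z') (N z0); last exact: le_trans zz.
apply: (zmin (Gamma x', z')); rewrite inE; split=> //=; split=> //=.
by exists x'.
Qed.

End Attainment.

Theorem proposition4p2 (R : realType) (n q : nat)
    (n_gt0 : (0 < n)%N) (q_gt0 : (0 < q)%N)
    (N : 'cV[R]_q -> R) (N_norm : is_norm N)
    (C : set 'cV[R]_q)
    (C_closed : closed C) (C_convex : convex_set C) (C_cone : is_cone C)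
    (C_solid : solid C) (C_pointed : pointed_cone C)
    (C_nontrivial : nontrivial_cone C)
    (X : set 'cV[R]_n) (X_convex : convex_set X)
    (Gamma : 'cV[R]_n -> 'cV[R]_q)
    (Gamma_convex : cone_convex C X Gamma)
    (Gamma_continuous : {within X, continuous Gamma})
    (XX : set 'cV[R]_n) (XX_sub : XX `<=` X)
    (XX_compact : compact XX) (XX_convex : convex_set XX)
    (XX_interior : XX° !=set0)
    (v : 'cV[R]_q) :
  (exists x z, primal_optimal N C XX Gamma v x z) /\
  (exists w, dual_optimal N C XX Gamma v w) /\
  primal_value N C XX Gamma v = dual_value N C XX Gamma v.
Proof.
have C0 : C 0 by case: C_nontrivial => [[+ _] _]; apply.
have XX0 : XX !=set0.
  by case: XX_interior => x /interior_subset XXx; exists x.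
have [x [z [feas opt]]] : exists x z, primal_optimal N C XX Gamma v x z.
  apply: primal_attained => //; exact: continuous_subspaceW Gamma_continuous.
pose S := upper_image C XX Gamma v.
have S0 : S !=set0 by exists z, x.
have SC y s : C y -> S s -> S (s + y).
  move=> Cy [t [/= XXt Ct]]; exists t; split=> //=.
  have := convex_coneD C_convex C_cone Ct Cy; rewrite /cone_le.
  by congr (C _); apply/colP => i; rewrite !mxE /=; ring.
have cS : convex_set S.
  exact: (upper_image_convex C_cone C_convex Gamma_convex XX_sub XX_convex).
have NS s : S s -> N z <= N s by move=> [t]; exact: opt.
have [w [wN wS]] := mazur_orlicz (is_norm_sublinear N_norm) cS S0 NS.
have wC : dual_cone C w by exact: (dual_cone_lbound C_cone S0 SC wS).
have dual_ge : ((N z)%:E <= dual_objective N C XX Gamma v w)%E.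
  apply: dual_objective_ge => // t y XXt.
  have : S (Gamma t - v).
    by exists t; split=> //=; rewrite /cone_le subKr subrr subr0.
  (* y is cancelled by wN, and Gamma t - v lies in S. *)
  move=> /wS; rewrite !dotpDr !dotpNr.
  by have := wN y; lra.
have dual_le w' := weak_duality N w' feas.
split; first by exists x, z.
split; first by exists w => w'; exact: le_trans (dual_le w') dual_ge.
transitivity (N z)%:E; apply/le_anti/andP; split.
- by apply: ereal_inf_lbound; exists (x, z).
- apply: le_ereal_inf_tmp => _ [[t y] feas' <-].
  by rewrite lee_fin; exact: opt feas'.
- by apply: le_trans dual_ge _; apply: ereal_sup_ubound; exists w.
- by apply: ge_ereal_sup => _ [w' _ <-]; exact: dual_le.
Qed.
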